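(* Let $r\ge1$ be an integer, let $a,\mu$ be real parameters and $\mathbf{n}=(n_1,\dots,n_r)\in\mathbb{N}_0^r$. Then for $(\xi_1,\dots,\xi_r)\in\mathbb{R}^r$, $$\mathcal{F}\big(f_r(x_1,\dots,x_r;n_1,\dots,n_r,a,\mu)\big)(\xi_1,\dots,\xi_r)=2^{2ra+\frac{r(r-5)}{4}+\sum_{j=1}^{r-1}jn_{j+1}}\prod_{j=1}^{r}\left\{\frac{\left(2\left(|\mathbf{n}^{j+1}|+\mu+\frac{r-j}{2}\right)\right)_{n_j}}{n_j!}\,\Theta_j^r(a,\mu,\mathbf{n};\xi_j)\right\},$$ where \begin{multline*} \Theta_j^r(a,\mu,\mathbf{n};\xi_j)=B\left(a+\frac{|\mathbf{n}^{j+1}|+i\xi_j}{2}+\frac{r-j}{4},\ a+\frac{|\mathbf{n}^{j+1}|-i\xi_j}{2}+\frac{r-j}{4}\right)\\ \times{}_3F_2\left(\begin{matrix}-n_j,\ n_j+2\left(|\mathbf{n}^{j+1}|+\mu+\frac{r-j}{2}\right),\ a+\frac{|\mathbf{n}^{j+1}|+i\xi_j}{2}+\frac{r-j}{4}\\ |\mathbf{n}^{j+1}|+\mu+\frac{r-j+1}{2},\ |\mathbf{n}^{j+1}|+2a+\frac{r-j}{2}\end{matrix}\;\Big|\;1\right). \end{multline*} Moreover, in terms of continuous Hahn polynomials, \begin{multline*} \Theta_j^r(a,\mu,\mathbf{n};\xi_j)=\frac{n_j!}{i^{n_j}\left(|\mathbf{n}^{j+1}|+\mu+\frac{r-j+1}{2}\right)_{n_j}\left(|\mathbf{n}^{j+1}|+2a+\frac{r-j}{2}\right)_{n_j}}\\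 \times B\left(a+\frac{|\mathbf{n}^{j+1}|+i\xi_j}{2}+\frac{r-j}{4},\ a+\frac{|\mathbf{n}^{j+1}|-i\xi_j}{2}+\frac{r-j}{4}\right)\\ \times p_{n_j}\Big(\frac{\xi_j}{2};\ a+\frac{|\mathbf{n}^{j+1}|}{2}+\frac{r-j}{4},\ \mu-a+\frac{|\mathbf{n}^{j+1}|+1}{2}+\frac{r-j}{4},\ \mu-a+\frac{|\mathbf{n}^{j+1}|+1}{2}+\frac{r-j}{4},\ a+\frac{|\mathbf{n}^{j+1}|}{2}+\frac{r-j}{4}\Big). \end{multline*}
   Context: Pochhammer symbol: $(\alpha)_0=1$, $(\alpha)_n=\alpha(\alpha+1)\cdots(\alpha+n-1)$. ${}_pF_q\left(\begin{matrix}a_1,\dots,a_p\\ b_1,\dots,b_q\end{matrix}\mid x\right)=\sum_{k\ge0}\frac{(a_1)_k\cdots(a_p)_k}{(b_1)_k\cdots(b_q)_k}\frac{x^k}{k!}$. Beta function $B(p,q)=\Gamma(p)\Gamma(q)/\Gamma(p+q)$. Gegenbauer polynomials: $C_n^{(\lambda)}(x)=\frac{(2\lambda)_n}{n!}\,{}_2F_1\left(\begin{matrix}-n,\ n+2\lambda\\ \lambda+\frac12\end{matrix}\mid\frac{1-x}{2}\right)$. Continuous Hahn polynomials: $p_n(x;a,b,c,d)=i^n\frac{(a+c)_n(a+d)_n}{n!}\,{}_3F_2\left(\begin{matrix}-n,\ n+a+b+c+d-1,\ a+ix\\ a+c,\ a+d\end{matrix}\mid1\right)$. Notation: for $\mathbf{n}=(n_1,\dots,n_r)$,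 $|\mathbf{n}^j|=n_j+\cdots+n_r$ for $1\le j\le r$, and $|\mathbf{n}^{r+1}|=0$. For $\boldsymbol{y}=(y_1,\dots,y_r)$, $\boldsymbol{y}_0=0$, $\boldsymbol{y}_j=(y_1,\dots,y_j)$, $\|\cdot\|$ the Euclidean norm. Ball polynomials: $P^{\mu}_{\mathbf{n}}(\boldsymbol{y})=\prod_{j=1}^{r}(1-\|\boldsymbol{y}_{j-1}\|^2)^{n_j/2}C^{(\lambda_j)}_{n_j}\big(y_j/\sqrt{1-\|\boldsymbol{y}_{j-1}\|^2}\big)$ with $\lambda_j=\mu+|\mathbf{n}^{j+1}|+\frac{r-j}{2}$. Define $f_r(x_1,\dots,x_r;n_1,\dots,n_r,a,\mu)=\prod_{j=1}^{r}(1-\tanh^2 x_j)^{a+\frac{r-j}{4}}\,P^{\mu}_{\mathbf{n}}(\upsilon_1,\dots,\upsilon_r)$, where $\upsilon_1=\tanh x_1$ and $\upsilon_j=\tanh x_j\sqrt{(1-\tanh^2x_1)\cdots(1-\tanh^2 x_{j-1})}$ for $j\ge2$. Fourier transform: $\mathcal{F}(f)(\xi_1,\dots,\xi_r)=\int_{\mathbb{R}^r}e^{-i(\xi_1x_1+\cdots+\xi_rx_r)}f(x_1,\dots,x_r)\,dx_1\cdots dx_r$.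
   Formalization: Assumes a > 0 (for a ≤ 0 the Fourier integral diverges unless f_r ≡ 0) and (|n^{j+1}|+μ+(r−j+1)/2)_{n_j} ≠ 0 for each j (otherwise the Gegenbauer ₂F₁ and the ₃F₂ are undefined); the integral over R^r is taken as an iterated integral. *)

(* Defs.v *)
From HB Require Import structures.
From mathcomp Require Import all_boot all_order all_algebra.
From mathcomp Require Import all_classical all_reals all_analysis.
From mathcomp Require Export complex.

Set Implicit Arguments.
Unset Strict Implicit.
Unset Printing Implicit Defensive.
Import Order.TTheory GRing.Theory Num.Theory numFieldNormedType.Exports.
Local Open Scope ring_scope.
Local Open Scope complex_scope.

Definition pochhammer {T : pzRingType} (alpha : T) (n : nat) : T :=
  \prod_(i < n) (alpha + i%:R).

Section Defs.
Variable R : realType.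
Local Notation C := R[i].

Definition cexpi (t : R) : C := cos t +i* sin t.

Definition climn (u : nat -> C) : C :=
  limn (fun N => complex.Re (u N)) +i* limn (fun N => complex.Im (u N)).

Definition pFq (as_ bs : seq C) (x : C) : C :=
  climn (fun N => \sum_(k < N)
     (\prod_(a <- as_) pochhammer a k) / (\prod_(b <- bs) pochhammer b k)
       * x ^+ k / (k`!)%:R).

Definition CInt (D : set R) (f : R -> C) : C :=
  Rintegral lebesgue_measure D (fun t => complex.Re (f t))
  +i* Rintegral lebesgue_measure D (fun t => complex.Im (f t)).

Definition cpowR (t : R) (z : C) : C :=
  (powR t (complex.Re z))%:C * cexpi (complex.Im z * ln t).

Definition Gamma (z : C) : C :=
  CInt `]0, +oo[%classic (fun t => cpowR t (z - 1) * (expR (- t))%:C).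

Definition Beta (p q : C) : C := Gamma p * Gamma q / Gamma (p + q).

Definition Gegenbauer (n : nat) (lambda x : R) : C :=
  (pochhammer (2 * lambda) n / (n`!)%:R)%:C *
  pFq [:: - (n%:R)%:C; (n%:R + 2 * lambda)%:C] [:: (lambda + 2^-1)%:C]
      (((1 - x) / 2)%:C).

Definition contHahn (n : nat) (x a b c d : C) : C :=
  'i ^+ n * pochhammer (a + c) n * pochhammer (a + d) n / (n`!)%:R *
  pFq [:: - n%:R; n%:R + a + b + c + d - 1; a + 'i * x] [:: a + c; a + d] 1.

(* Indices are 1-based: n j = n_j for 1 <= j <= r (other values unused). *)
Definition nsuf (r : nat) (n : nat -> nat) (j : nat) : nat :=
  \sum_(j <= k < r.+1) n k.

Definition sqnorm_pre (y : nat -> R) (j : nat) : R :=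
  \sum_(1 <= k < j.+1) y k ^+ 2.

Definition ball_lambda (r : nat) (mu : R) (n : nat -> nat) (j : nat) : R :=
  mu + (nsuf r n j.+1)%:R + (r%:R - j%:R) / 2.

Definition ballP (r : nat) (mu : R) (n : nat -> nat) (y : nat -> R) : C :=
  \prod_(1 <= j < r.+1)
    ((powR (1 - sqnorm_pre y j.-1) ((n j)%:R / 2))%:C *
     Gegenbauer (n j) (ball_lambda r mu n j)
       (y j / Num.sqrt (1 - sqnorm_pre y j.-1))).

Definition tanh (x : R) : R := (expR x - expR (- x)) / (expR x + expR (- x)).

Definition upsilon (x : nat -> R) (j : nat) : R :=
  tanh (x j) * Num.sqrt (\prod_(1 <= i < j) (1 - tanh (x i) ^+ 2)).

Definition f_r (r : nat) (n : nat -> nat) (a mu : R) (x : nat -> R) : C :=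
  (\prod_(1 <= j < r.+1)
     powR (1 - tanh (x j) ^+ 2) (a + (r%:R - j%:R) / 4))%:C *
  ballP r mu n (upsilon x).

(* Iterated Lebesgue integral over R^k of F in the variables x_1, ..., x_k
   (x_1 innermost, x_k outermost); other coordinates are set to 0. *)
Fixpoint iint (k : nat) (F : (nat -> R) -> C) : C :=
  match k with
  | 0 => F (fun _ => 0)
  | k'.+1 => CInt setT (fun t =>
      iint k' (fun y => F (fun i => if i == k'.+1 then t else y i)))
  end.

Definition fourier (r : nat) (f : (nat -> R) -> C) (xi : nat -> R) : C :=
  iint r (fun x => cexpi (- \sum_(1 <= j < r.+1) xi j * x j) * f x).

Definition theta_arg (r : nat) (a : R) (n : nat -> nat) (j : nat) (s : R) : C :=
  (a + (nsuf r n j.+1)%:R / 2 + (r%:R - j%:R) / 4) +i* (s / 2).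

Definition Theta (r : nat) (a mu : R) (n : nat -> nat) (j : nat) (s : R) : C :=
  let N : R := (nsuf r n j.+1)%:R in
  Beta (theta_arg r a n j s) (theta_arg r a n j (- s)) *
  pFq [:: - ((n j)%:R)%:C;
          ((n j)%:R + 2 * (N + mu + (r%:R - j%:R) / 2))%:C;
          theta_arg r a n j s]
      [:: (N + mu + (r%:R - j%:R + 1) / 2)%:C;
          (N + 2 * a + (r%:R - j%:R) / 2)%:C] 1.

End Defs.

(* Main.v *)
(** Since 1 - ||upsilon_(j-1)||^2 is the product of the 1 - tanh^2 x_i for
    i < j, the function f_r is a product of functions of one variable, namely
    (1 - tanh^2 x_j)^A C_(n_j)^(lambda_j)(tanh x_j) with
    A = a + |n^(j+1)| / 2 + (r - j) / 4, so its Fourier transform is a product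
    of one-dimensional transforms. Expanding the Gegenbauer polynomial in powers
    of u = (1 - tanh x) / 2 = 1 / (1 + e^(2x)) reduces each of them to
    4^A times the integrals of u^(A + k + i xi / 2) (1 - u)^(A - i xi / 2) over
    the real line, which are Beta integrals, and
    B(p + k, q) = B(p, q) (p)_k / (p + q)_k yields the 3F2.

    The Beta integral is obtained without leaving the real line: Gamma p is the
    integral of Phi_p(y) = e^(p y) exp(- e^y), and
    Phi_q(z + w) Phi_p(z)
      = e^(q w) (1 + e^w)^(- p - q) Phi_(p+q)(z + ln(1 + e^w)),
    so that Fubini and translation invariance suffice. All integrands decay
    like e^(- m |x|), which provides integrability throughout. *)

Require Import Defs.
From HB Require Import structures.
From mathcomp Require Import all_boot all_order all_algebra.
From mathcomp Require Import all_classical all_reals all_analysis.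
From mathcomp Require Import complex measurable_realfun.
From mathcomp Require Import ring lra.
Import Order.TTheory GRing.Theory Num.Theory.
Local Open Scope ring_scope.
Local Open Scope complex_scope.

(** * Real integrals *)

Section RealIntegrals.
Import numFieldNormedType.Exports.
Local Open Scope classical_set_scope.
Context {R : realType}.
Local Notation mu := (@lebesgue_measure R).
Local Notation integrable f := (integrable mu setT (EFin \o f)).

Lemma bigcup_itvNnn : \bigcup_n `[- n%:R, n%:R] = [set: R].
Proof.
apply/seteqP; split => // x _.
exists (Num.truncn `|x|).+1 => //=.
rewrite in_itv /= -ler_norml.
by apply/ltW/truncnS_gt.
Qed.

(** Dominated convergence for the truncations of [f], with dominating function [|f|]. Compact
    intervals are where the fundamental theorem of calculus applies. *)
Lemma cvg_Rintegral_itvNnn (f : R -> R) : integrable f ->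
  (\int[mu]_(x in `[- n%:R, n%:R]) f x) @[n --> \oo] --> \int[mu]_x f x.
Proof.
move=> intf.
have mf := measurable_int _ intf.
have [] := @dominated_convergence _ _ R mu setT measurableT
   (fun n => EFin \o (f \_ `[- n%:R, n%:R])) (EFin \o f) (abse \o (EFin \o f)).
- move=> n; apply/measurable_EFinP.
  have mD : measurable (`[- n%:R, n%:R] : set R) by [].
  apply: (measurable_restrictT f mD).1.
  by apply: measurable_funTS; exact/measurable_EFinP.
- by [].
- apply: aeW => x _; apply: cvg_near_cst.
  near=> n; rewrite /= patchE mem_set //=; last rewrite /= in_itv /= -ler_norml.
  by near: n; exact: nbhs_infty_ger.
- exact: integrable_abse.
- apply: aeW => x n _ /=; rewrite patchE; case: ifP => _ //=.
  by rewrite /point /= normr0 lee_fin.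
move=> _ _ /= h.
apply: fine_cvg.
rewrite fineK; last exact: integrable_fin_num.
move: h; apply: cvg_trans; apply: near_eq_cvg; near=> n.
rewrite [RHS]integral_mkcond.
  by rewrite restrict_EFin.
Unshelve. all: by end_near. Qed.

Lemma integrable_ge0_lty (f : R -> R) : measurable_fun [set: R] f ->
  (forall x, 0 <= f x) -> (\int[mu]_x (f x)%:E < +oo)%E -> integrable f.
Proof.
move=> mf f0 h; apply/integrableP; split; first exact/measurable_EFinP.
by under eq_integral do rewrite /= ger0_norm //.
Qed.

Lemma cvg_expRNM (m : R) : 0 < m -> expR (- (m * x)) @[x --> +oo] --> (0 : R).
Proof.
move=> m0; apply: (cvg_comp (fun x => m * x) (fun y => expR (- y)) _ (@cvgr_expR R)).
by apply: gt0_cvgMry => //; exact: cvg_id.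
Qed.

(** By symmetry only the half-line matters, where [- m^-1 * expR (- m * x)] is an antiderivative
    with limit 0. *)
Lemma integrable_expNM_norm (m : R) : 0 < m ->
  integrable (fun x => expR (- (m * `|x|))).
Proof.
move=> m0.
have cf : continuous (fun x : R => expR (- (m * `|x|))).
  move=> x; apply: (@continuous_comp _ _ _ (fun x => - (m * `|x|)) expR).
    apply: cvgN; apply: cvgMl_tmp; exact: norm_continuous.
  exact: continuous_expR.
apply: integrable_ge0_lty.
- exact: continuous_measurable_fun.
- by move=> x; exact: expR_ge0.
rewrite ge0_symfun_integralT //; last first.
  by move=> x /=; rewrite normrN.
rewrite -set_itvcy.
have -> : (\int[mu]_(x in `[0%R, +oo[) (expR (- (m * `|x|)))%:E =
           \int[mu]_(x in `[0%R, +oo[) (expR (- m * x))%:E)%E.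
  apply: eq_integral => x; rewrite inE /= in_itv /= andbT => x0.
  by rewrite ger0_norm // mulNr.
have cE : continuous (fun x : R => expR (- m * x)).
  move=> x; apply: (@continuous_comp _ _ _ (fun x => - m * x) expR).
    by apply: cvgMl_tmp; exact: cvg_id.
  exact: continuous_expR.
rewrite (@ge0_continuous_FTC2y _ _ (fun x => - m^-1 * expR (- m * x)) _ 0) //.
- by rewrite -EFinB -EFinM ltry.
- exact: continuous_subspaceT.
- rewrite -(mulr0 (- m^-1)); apply: cvgMl_tmp.
  by under eq_fun do rewrite mulNr; exact: cvg_expRNM.
- by apply: cvg_at_right_filter; apply: cvgMl_tmp; exact: cE.
move=> x _; rewrite derive1E derive_val /GRing.scale /=.
have mn0 : m != 0 by rewrite gt_eqF.
by field.
Unshelve. all: by end_near. Qed.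

Lemma integrable_dominated (f : R -> R) (K m : R) : measurable_fun [set: R] f ->
  0 < m -> (forall x, `|f x| <= K * expR (- (m * `|x|))) -> integrable f.
Proof.
move=> mf m0 fK.
have h := integrableZl measurableT K (integrable_expNM_norm m m0).
apply: le_integrable h => //; first exact/measurable_EFinP.
move=> x _ /=; rewrite lee_fin (le_trans (fK x)) // ler_norm //.
Qed.

(** Splitting into positive and negative parts lets substitution rules for nonnegative functions
    carry over to signed ones. *)
Lemma RintegralE (D : set R) (f : R -> R) :
  \int[mu]_(x in D) f x =
  fine (\int[mu]_(x in D) (Num.max (f x) 0)%:E
        - \int[mu]_(x in D) (Num.max (- f x) 0)%:E)%E.
Proof.
rewrite /Rintegral integralE; congr (fine (_ - _)%E); apply: eq_integral => x _.
  by rewrite funeposE EFin_max.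
by rewrite funenegE EFin_max.
Qed.

Lemma ge0_integral_affine (f : R -> R) (k b : R) : 0 < k -> continuous f ->
  (forall x, 0 <= f x) ->
  (\int[mu]_x (f x)%:E = k%:E * \int[mu]_x (f (k * x + b))%:E)%E.
Proof.
move=> k0 cf f0.
have dF : (fun x : R => k * x + b)^`() = cst k.
  apply/funext => x; rewrite derive1E derive_val /GRing.scale /=.
  by rewrite mulr1 addr0.
have cF : continuous (fun x : R => k * x + b).
  move=> x; apply: cvgD; last exact: cvg_cst.
  by apply: cvgMl_tmp; exact: cvg_id.
rewrite (@increasing_ge0_integration_by_substitutionT _ (fun x => k * x + b)) //.
- rewrite dF -ge0_integralZl //.
  + by apply: eq_integral => x _; rewrite /= -EFinM mulrC.
  + apply/measurable_EFinP; apply: continuous_measurable_fun => x.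
    by apply: (@continuous_comp _ _ _ (fun x => k * x + b) f);
      [exact: cF|exact: cf].
  + by move=> x _; rewrite lee_fin.
  + by rewrite lee_fin ltW.
- by move=> x y xy; rewrite ltrD2r ltr_pM2l.
- by rewrite dF; exact: cst_continuous.
- by rewrite dF; exact: is_cvg_cst.
- by rewrite dF; exact: is_cvg_cst.
- apply: (cvg_comp (fun x => k * x) (fun y => y + b) _ (cvg_addrr_Ny b)).
  by apply: gt0_cvgMrNy => //; exact: cvg_id.
- apply: (cvg_comp (fun x => k * x) (fun y => y + b) _ (cvg_addrr b)).
  by apply: gt0_cvgMry => //; exact: cvg_id.
Qed.

End RealIntegrals.

(** * Affine and exponential substitutions, vanishing boundary terms *)

Section Substitutions.
Import numFieldNormedType.Exports.
Local Open Scope classical_set_scope.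
Context {R : realType}.
Local Notation mu := (@lebesgue_measure R).
Local Notation integrable f := (integrable mu setT (EFin \o f)).

Lemma continuous_affine (f : R -> R) (k b : R) : continuous f ->
  continuous (fun x => f (k * x + b)).
Proof.
move=> cf x; apply: (@continuous_comp _ _ _ (fun x => k * x + b) f _ _ (cf _)).
apply: cvgD; last exact: cvg_cst.
by apply: cvgMl_tmp; exact: cvg_id.
Qed.

Lemma continuous_max0 (f : R -> R) : continuous f ->
  continuous (fun x => Num.max (f x) 0).
Proof. by move=> cf x; apply: continuous_max; [exact: cf|exact: cvg_cst]. Qed.

Lemma integrable_affine (f : R -> R) (k b : R) : 0 < k -> continuous f ->
  integrable f -> integrable (fun x => f (k * x + b)).
Proof.
move=> k0 cf /integrableP[_ fi].
apply/integrableP; split.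
  apply/measurable_EFinP; apply: continuous_measurable_fun.
  exact: continuous_affine.
move: fi; rewrite /=.
rewrite (@ge0_integral_affine _ (fun x => `|f x|) k b) //; last first.
  by move=> x; apply: (@continuous_comp _ _ _ f Num.norm);
    [exact: cf|exact: norm_continuous].
case: (integral _ _ _) => [r||] //.
  by move=> _; rewrite ltry.
by rewrite gt0_muley ?lte_fin.
Qed.

(** Multiplication by [k > 0] fixes the infinite values, and [fine] sends these to 0, so the
    identity survives when [x] or [y] is infinite. *)
Lemma fine_muleB (k : R) (x y : \bar R) : 0 < k ->
  fine (k%:E * x - k%:E * y)%E = k * fine (x - y)%E.
Proof.
move=> k0; case: x => [x||]; case: y => [y||] //=;
  rewrite ?gt0_muley ?gt0_muleNy ?lte_fin //= ?mulr0 //.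
by rewrite mulrBr.
Qed.

Lemma Rintegral_affine (f : R -> R) (k b : R) : 0 < k -> continuous f ->
  \int[mu]_x f x = k * \int[mu]_x f (k * x + b).
Proof.
move=> k0 cf.
rewrite !RintegralE.
rewrite (@ge0_integral_affine _ (fun x => Num.max (f x) 0) k b) //; first last.
- by move=> x; rewrite le_max lexx orbT.
- exact: continuous_max0.
rewrite (@ge0_integral_affine _ (fun x => Num.max (- f x) 0) k b) //;
  first last.
- by move=> x; rewrite le_max lexx orbT.
- by apply: continuous_max0 => x; apply: cvgN; exact: cf.
exact: fine_muleB.
Qed.

Lemma continuous_Rintegral_itv (F f : R -> R) (a b : R) : a < b ->
  (forall x : R, is_derive x (1 : R) F (f x)) -> continuous f ->
  \int[mu]_(x in `[a, b]) f x = F b - F a.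
Proof.
move=> ab dF cf.
have cF : continuous F.
  by move=> x; apply: differentiable_continuous; apply/derivable1_diffP.
rewrite /Rintegral (@continuous_FTC2 _ f F) //.
- exact: continuous_subspaceT.
- split => //.
  + by apply: cvg_at_right_filter; exact: cF.
  + by apply: cvg_at_left_filter; exact: cF.
- by move=> x _; rewrite derive1E derive_val.
Qed.

(** The integral over [[-n, n]] is [F n - F (- n)], which the exponential bound squeezes to 0. This
    is the integration by parts behind the functional equation of Gamma. *)
Lemma Rintegral_derive_eq0 (F f : R -> R) (K m : R) : 0 < m ->
  (forall x : R, is_derive x (1 : R) F (f x)) -> continuous f -> integrable f ->
  (forall x, `|F x| <= K * expR (- (m * `|x|))) ->
  \int[mu]_x f x = 0.
Proof.
move=> m0 dF cf fi FK.
rewrite -(cvg_lim (@Rhausdorff R) (cvg_Rintegral_itvNnn _ fi)).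
apply: (cvg_lim (@Rhausdorff R)).
have e0 : K * expR (- (m * n%:R)) @[n --> \oo] --> (0 : R).
  rewrite -(mulr0 K); apply: cvgMl_tmp.
  exact: (cvg_comp (fun n : nat => n%:R) (fun x => expR (- (m * x))) (@cvgr_idn R) (cvg_expRNM _ m0)).
have sq (G : nat -> R) : (forall n, `|G n| <= K * expR (- (m * n%:R))) ->
    G n @[n --> \oo] --> (0 : R).
  move=> h; apply: norm_cvg0.
  have hG : \forall n \near \oo, 0 <= `|G n| <= K * expR (- (m * n%:R)).
    by near=> n; rewrite normr_ge0 h.
  exact: (squeeze_cvgr hG (cvg_cst _) e0).
have e1 : F n%:R @[n --> \oo] --> 0.
  by apply: sq => n; rewrite (le_trans (FK _)) // ger0_norm.
have e2 : F (- n%:R) @[n --> \oo] --> 0.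
  by apply: sq => n; rewrite (le_trans (FK _)) // normrN ger0_norm.
have : F n%:R - F (- n%:R) @[n --> \oo] --> (0 : R).
  by rewrite -[X in _ --> X]subr0; exact: cvgB.
apply: cvg_trans; apply: near_eq_cvg.
near=> n; apply/esym/continuous_Rintegral_itv => //.
rewrite (@lt_trans _ _ 0) ?oppr_lt0 // ltr0n; near: n; exact: nbhs_infty_gt.
Unshelve. all: by end_near. Qed.

(** On each [[-n, n]] this is substitution on a compact interval; the images exhaust the open
    half-line and monotone convergence passes to the limit on both sides. Continuity is asked only
    away from 0 because the integrands in view contain [ln]. *)
Lemma ge0_integral_expR (g : R -> R) :
  {in `]0, +oo[%R, continuous g} -> (forall x, 0 <= g x) ->
  (\int[mu]_(x in `]0%R, +oo[) (g x)%:E = \int[mu]_x (g (expR x) * expR x)%:E)%E.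
Proof.
move=> cg g0.
have c1 : continuous (fun x => g (expR x) * expR x).
  move=> x; apply: cvgM; last exact: continuous_expR.
  apply: (@continuous_comp _ _ _ expR g); first exact: continuous_expR.
  by apply: cg; rewrite in_itv /= expR_gt0.
have dE : (@expR R)^`() = expR.
  by apply/funext => x; rewrite derive1E derive_val.
have e : \bigcup_n `[expR (- n%:R), expR n%:R] = `]0, +oo[%classic :> set R.
  apply/seteqP; split => x.
    by case=> n _ /=; rewrite !in_itv /= andbT => /andP[+ _];
      apply: lt_le_trans; exact: expR_gt0.
  rewrite /= in_itv /= andbT => x0.
  have : (ln x) \in [set: R] by rewrite inE.
  rewrite -bigcup_itvNnn inE => -[n _] /=; rewrite in_itv /= => /andP[h h'].
  exists n => //=; rewrite in_itv /=.
  by rewrite -[x in (_ <= x <= _)%O]lnK ?posrE // !ler_expR h h'.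
have lim1 : (\int[mu]_(x in `[(- n%:R)%R, n%:R%R]) (g (expR x) * expR x)%:E)%E
    @[n --> \oo] --> (\int[mu]_x (g (expR x) * expR x)%:E)%E.
  rewrite -bigcup_itvNnn.
  apply: ge0_nondecreasing_set_cvg_integral => //.
  - move=> n k nk; apply/subsetPset => x /=; rewrite !in_itv /= => /andP[h h'].
    have nk' : n%:R <= k%:R :> R by rewrite ler_nat.
    by rewrite (le_trans _ h) ?lerN2 // (le_trans h').
  - by move=> n; apply/measurable_EFinP/measurable_funTS;
    exact: continuous_measurable_fun.
  - by move=> n x _; rewrite lee_fin mulr_ge0 // expR_ge0.
have lim2 : (\int[mu]_(x in `[expR (- n%:R)%R, expR n%:R%R]) (g x)%:E)%E
    @[n --> \oo] --> (\int[mu]_(x in `]0%R, +oo[) (g x)%:E)%E.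
  rewrite -e.
  apply: ge0_nondecreasing_set_cvg_integral => //.
  - move=> n k nk; apply/subsetPset => x /=; rewrite !in_itv /= => /andP[h h'].
    have nk' : n%:R <= k%:R :> R by rewrite ler_nat.
    by rewrite (le_trans _ h) ?ler_expR ?lerN2 // (le_trans h') // ler_expR.
  - move=> n; apply/measurable_EFinP.
    have mg : measurable_fun (`]0%R, +oo[ : set R) g.
      apply: open_continuous_measurable_fun => //.
      by move=> x; rewrite inE => xI; exact: cg.
    by apply: measurable_funS mg => //; rewrite -e => x xn; exists n.
  - by move=> n x _; rewrite lee_fin.
apply: (cvg_unique (@ereal_hausdorff R) lim2).
move: lim1; apply: cvg_trans; apply: near_eq_cvg; near=> n.
apply/esym.
rewrite (@integration_by_substitution_increasing _ expR g) //.
- by apply: eq_integral => x _; rewrite /= fctE derive1E derive_val.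
- by rewrite (@le_trans _ _ 0) // oppr_le0.
- by move=> x y _ _; rewrite ltr_expR.
- by rewrite dE => x _; exact: continuous_expR.
- by rewrite dE; apply/cvg_ex; eexists; apply: cvg_at_right_filter;
  exact: continuous_expR.
- by rewrite dE; apply/cvg_ex; eexists; apply: cvg_at_left_filter;
  exact: continuous_expR.
- split.
  + by move=> x _; exact: derivable_expR.
  + by apply: cvg_at_right_filter; exact: continuous_expR.
  + by apply: cvg_at_left_filter; exact: continuous_expR.
- apply: continuous_in_subspaceT => x; rewrite inE /= in_itv /= => /andP[h _].
  by apply: cg; rewrite in_itv /= andbT (lt_le_trans _ h) ?expR_gt0.
Unshelve. all: by end_near. Qed.

Lemma Rintegral_expR (g : R -> R) : {in `]0, +oo[%R, continuous g} ->
  \int[mu]_(x in `]0%R, +oo[) g x = \int[mu]_x (g (expR x) * expR x).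
Proof.
move=> cg; rewrite !RintegralE; congr fine.
have c0 : {in `]0, +oo[%R, continuous (fun x => Num.max (g x) 0)}.
  by move=> x /cg cgx; apply: (continuous_max cgx); exact: cvg_cst.
have cN : {in `]0, +oo[%R, continuous (fun x => Num.max (- g x) 0)}.
  move=> x /cg cgx; apply: (continuous_max (f := fun x => - g x));
    last exact: cvg_cst.
  by apply: cvgN; exact: cgx.
rewrite (ge0_integral_expR _ c0); last by move=> x; rewrite le_max lexx orbT.
rewrite (ge0_integral_expR _ cN); last by move=> x; rewrite le_max lexx orbT.
congr (_ - _)%E; apply: eq_integral => x _; rewrite maxr_pMl ?expR_ge0 //
  mul0r //.
by rewrite mulNr.
Qed.

End Substitutions.

(** * Exponentially dominated functions and the integral of a convolution *)

Section Convolution.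
Import numFieldNormedType.Exports.
Local Open Scope classical_set_scope.
Context {R : realType}.
Local Notation mu := (@lebesgue_measure R).
Local Notation integrable f := (integrable mu setT (EFin \o f)).

(** The class containing the real and imaginary parts of the Gamma and Beta integrands: the bound
    gives integrability and boundedness, continuity gives measurability and the substitution
    rules. *)
Definition expdom (f : R -> R) := continuous f /\
  exists K m : R, 0 < m /\ forall x, `|f x| <= K * expR (- (m * `|x|)).

Lemma expdom_integrable (f : R -> R) : expdom f -> integrable f.
Proof.
move=> [cf [K [m [m0 fK]]]]; apply: (integrable_dominated _ K m) => //.
exact: continuous_measurable_fun.
Qed.

Lemma expdom_bounded (f : R -> R) : expdom f -> exists K, forall x, `|f x| <= K.
Proof.
move=> [cf [K [m [m0 fK]]]]; exists K => x; apply: (le_trans (fK x)).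
have K0 : 0 <= K.
  by have := le_trans (normr_ge0 _) (fK 0);
    rewrite normr0 mulr0 oppr0 expR0 mulr1.
by rewrite ler_piMr // expR_le1 oppr_le0 mulr_ge0 // ltW.
Qed.

Context (phi psi : R -> R) (dphi : expdom phi) (dpsi : expdom psi).

Let mphi : measurable_fun [set: R] phi.
Proof. by case: dphi => cphi _; exact: continuous_measurable_fun. Qed.

Let mpsi : measurable_fun [set: R] psi.
Proof. by case: dpsi => cpsi _; exact: continuous_measurable_fun. Qed.

Let iphi := expdom_integrable _ dphi.
Let ipsi := expdom_integrable _ dpsi.

Let F (wz : R * R) := (phi (wz.2 + wz.1) * psi wz.2)%:E.

Let mF : measurable_fun [set: R * R] F.
Proof.
apply/measurable_EFinP; apply: measurable_funM.
  by apply: (measurableT_comp mphi); exact: measurable_funD.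
exact: (measurableT_comp mpsi).
Qed.

(** Tonelli: for fixed [z], translation invariance makes the integral in [w] equal to [|psi z|]
    times the L1 norm of [phi], and integrating in [z] leaves a product of two finite L1 norms. *)
Let iF : (mu \x mu)%E.-integrable setT F.
Proof.
apply/(integrable21ltyP mu mu mF).
have -> : (\int[mu]_y \int[mu]_x `|F (x, y)| = \int[mu]_x (`|psi x|%:E * \int[mu]_y `|phi y|%:E))%E.
  apply: eq_integral => z _.
  have [cphi _] := dphi.
  rewrite (@ge0_integral_affine _ (fun x => `|phi x|) 1 z) //; last first.
    by move=> x; apply: (@continuous_comp _ _ _ phi Num.norm);
      [exact: cphi|exact: norm_continuous].
  rewrite mul1e -ge0_integralZl //.
    by apply: eq_integral => w _; rewrite /F /= normrM mulrC EFinM mul1r addrC.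
  apply/measurable_EFinP; apply: (measurableT_comp (@normr_measurable R setT)).
  apply: continuous_measurable_fun; exact: continuous_affine.
case/integrableP: iphi => _ h1; case/integrableP: ipsi => m2 h2.
rewrite ge0_integralZr //; last 2 first.
- by move: m2 => /measurable_EFinP m2; apply/measurable_EFinP;
  exact: measurableT_comp.
- by apply: integral_ge0.
by rewrite lte_mul_pinfty // ?integral_ge0 // ge0_fin_numE // integral_ge0.
Qed.

(** A bounded factor times an integrable one. This holds for every [w], not just almost every one,
    so the inner integrals are finite throughout. *)
Lemma integrable_convr (w : R) : integrable (fun z => phi (z + w) * psi z).
Proof.
have [K phiK] := expdom_bounded _ dphi.
have h := integrableZl measurableT K ipsi.
apply: le_integrable h => //.
  apply/measurable_EFinP; apply: measurable_funM => //.
  by apply: (measurableT_comp mphi); exact: measurable_funD.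
move=> x _ /=; rewrite lee_fin !normrM ler_wpM2r //.
by rewrite (le_trans (phiK _)) // ler_norm.
Qed.

Let convE w : (\int[mu]_z F (w, z) = (\int[mu]_z (phi (z + w) * psi z))%:E)%E.
Proof. by rewrite fineK //;
  exact: (integrable_fin_num _ (integrable_convr w)). Qed.

Lemma integrable_conv : integrable (fun w => \int[mu]_z (phi (z + w) * psi z)).
Proof.
have := integrable_fubini_F iF; rewrite /fubini_F.
by under eq_fun do rewrite convE.
Qed.

Lemma Rintegral_conv :
  \int[mu]_w (\int[mu]_z (phi (z + w) * psi z)) = \int[mu]_x phi x * \int[mu]_x psi x.
Proof.
rewrite {1}/Rintegral; under eq_integral do rewrite -convE.
rewrite (Fubini iF).
have -> : (\int[mu]_y \int[mu]_x F (x, y) = \int[mu]_z ((\int[mu]_x phi x) * psi z)%:E)%E.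
  apply: eq_integral => z _; rewrite /F /=.
  have [cphi _] := dphi.
  have ip := integrable_affine _ 1 z ltr01 cphi iphi.
  rewrite (@Rintegral_affine _ phi 1 z) // mul1r -RintegralZr //.
  rewrite /Rintegral fineK; last first.
    by apply: integrable_fin_num => //;
      have := integrableZr measurableT (psi z) ip.
  by apply: eq_integral => w _; rewrite mul1r addrC.
exact: RintegralZl.
Qed.

End Convolution.

(** * Complex-valued integrals *)

Section ComplexIntegrals.
Import numFieldNormedType.Exports.
Local Open Scope classical_set_scope.
Context {R : realType}.
Local Notation C := R[i].
Local Notation mu := (@lebesgue_measure R).
Local Notation integrable f := (integrable mu setT (EFin \o f)).
Local Notation Re := (@complex.Re R).
Local Notation Im := (@complex.Im R).

Lemma Re_mulc (x y : C) : Re (x * y) = Re x * Re y - Im x * Im y.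
Proof. by case: x; case: y. Qed.

Lemma Im_mulc (x y : C) : Im (x * y) = Re x * Im y + Im x * Re y.
Proof. by case: x; case: y. Qed.

Lemma complex_eq (x y : C) : Re x = Re y -> Im x = Im y -> x = y.
Proof. by case: x; case: y => ? ? ? ? /= -> ->. Qed.

Lemma Re_subc (x y : C) : Re (x - y) = Re x - Re y.
Proof. by rewrite raddfB. Qed.

Lemma Re_addc (x y : C) : Re (x + y) = Re x + Re y.
Proof. by rewrite raddfD. Qed.

Lemma Im_addc (x y : C) : Im (x + y) = Im x + Im y.
Proof. by rewrite raddfD. Qed.

Lemma Im_subc (x y : C) : Im (x - y) = Im x - Im y.
Proof. by rewrite raddfB. Qed.

Definition cintegrable (f : R -> C) :=
  integrable (fun x => Re (f x)) /\ integrable (fun x => Im (f x)).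

Lemma eq_CInt (D : set R) (f g : R -> C) : (forall x, D x -> f x = g x) ->
  CInt D f = CInt D g.
Proof.
move=> fg; congr (_ +i* _); apply: eq_Rintegral => x; rewrite inE => Dx;
  by rewrite fg.
Qed.

Lemma integrable_EFinB (f g : R -> R) : integrable f -> integrable g ->
  integrable (fun x => f x - g x).
Proof. by move=> fi gi; have := integrableB measurableT fi gi. Qed.

Lemma integrable_EFinD (f g : R -> R) : integrable f -> integrable g ->
  integrable (fun x => f x + g x).
Proof. by move=> fi gi; have := integrableD measurableT fi gi. Qed.

Lemma integrable_EFinZl (k : R) (f : R -> R) : integrable f ->
  integrable (fun x => k * f x).
Proof. by move=> fi; have := integrableZl measurableT k fi. Qed.

Lemma Rintegral_setTB (f g : R -> R) : integrable f -> integrable g ->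
  \int[mu]_x (f x - g x) = \int[mu]_x f x - \int[mu]_x g x.
Proof. by move=> fi gi; exact: RintegralB. Qed.

Lemma Rintegral_setTD (f g : R -> R) : integrable f -> integrable g ->
  \int[mu]_x (f x + g x) = \int[mu]_x f x + \int[mu]_x g x.
Proof. by move=> fi gi; exact: RintegralD. Qed.

Lemma Rintegral_setTZl (k : R) (f : R -> R) : integrable f ->
  \int[mu]_x (k * f x) = k * \int[mu]_x f x.
Proof. by move=> fi; exact: RintegralZl. Qed.

Lemma cintegrableZ (c : C) (f : R -> C) : cintegrable f ->
  cintegrable (fun x => c * f x).
Proof.
move=> [rf jf]; split.
- under eq_fun do rewrite Re_mulc.
  by apply: integrable_EFinB; exact: integrable_EFinZl.
- under eq_fun do rewrite Im_mulc.
  by apply: integrable_EFinD; exact: integrable_EFinZl.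
Qed.

Lemma CIntZ (c : C) (f : R -> C) : cintegrable f ->
  CInt setT (fun x => c * f x) = c * CInt setT f.
Proof.
move=> [rf jf]; apply: complex_eq; rewrite ?Re_mulc ?Im_mulc /=.
- under eq_Rintegral do rewrite Re_mulc.
  by rewrite Rintegral_setTB ?Rintegral_setTZl //; exact: integrable_EFinZl.
- under eq_Rintegral do rewrite Im_mulc.
  by rewrite Rintegral_setTD ?Rintegral_setTZl //; exact: integrable_EFinZl.
Qed.

Lemma cintegrableD (f g : R -> C) : cintegrable f -> cintegrable g ->
  cintegrable (fun x => f x + g x).
Proof.
move=> [rf jf] [rg jg]; split.
- under eq_fun do rewrite raddfD.
  exact: integrable_EFinD.
- under eq_fun do rewrite raddfD.
  exact: integrable_EFinD.
Qed.

Lemma CIntD (f g : R -> C) : cintegrable f -> cintegrable g ->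
  CInt setT (fun x => f x + g x) = CInt setT f + CInt setT g.
Proof.
move=> [rf jf] [rg jg]; apply: complex_eq; rewrite raddfD /=.
- by under eq_Rintegral do rewrite raddfD; exact: RintegralD.
- by under eq_Rintegral do rewrite raddfD; exact: RintegralD.
Qed.

Lemma cintegrable0 : cintegrable (fun=> 0).
Proof. by split; exact: (integrable0 mu setT). Qed.

Lemma CInt0 : CInt setT (fun=> 0 : C) = 0.
Proof.
by apply: complex_eq => /=; rewrite Rintegral_cst // mul0r.
Qed.

Lemma cintegrable_sum (n : nat) (f : nat -> R -> C) :
  (forall k, (k < n)%N -> cintegrable (f k)) ->
  cintegrable (fun x => \sum_(k < n) f k x).
Proof.
elim: n => [|n IH] fi.
  by under eq_fun do rewrite big_ord0; exact: cintegrable0.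
under eq_fun do rewrite big_ord_recr /=.
by apply: cintegrableD; [apply: IH => k kn; apply: fi; exact: ltnW|exact: fi].
Qed.

Lemma CInt_sum (n : nat) (f : nat -> R -> C) :
  (forall k, (k < n)%N -> cintegrable (f k)) ->
  CInt setT (fun x => \sum_(k < n) f k x) = \sum_(k < n) CInt setT (f k).
Proof.
elim: n => [|n IH] fi.
  by under eq_fun do rewrite big_ord0; rewrite big_ord0 CInt0.
under eq_fun do rewrite big_ord_recr /=.
rewrite CIntD; last 2 first.
- by apply: cintegrable_sum => k kn; apply: fi; exact: ltnW.
- exact: fi.
by rewrite big_ord_recr /= IH // => k kn; apply: fi; exact: ltnW.
Qed.

Definition cexpdom (f : R -> C) :=
  expdom (fun x => Re (f x)) /\ expdom (fun x => Im (f x)).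

Lemma cexpdom_cintegrable f : cexpdom f -> cintegrable f.
Proof. by move=> [rf jf]; split; exact: expdom_integrable. Qed.

Lemma cexpdom_cintegrable_affine f (k b : R) : 0 < k -> cexpdom f ->
  cintegrable (fun x => f (k * x + b)).
Proof.
move=> k0 [rf jf]; split.
- apply: (integrable_affine (fun x => Re (f x))) => //;
  last exact: expdom_integrable.
  by case: rf.
- apply: (integrable_affine (fun x => Im (f x))) => //;
  last exact: expdom_integrable.
  by case: jf.
Qed.

Lemma CInt_affine f (k b : R) : 0 < k -> cexpdom f ->
  CInt setT f = k%:C * CInt setT (fun x => f (k * x + b)).
Proof.
move=> k0 [[cr _] [cj _]]; apply: complex_eq;
  rewrite ?Re_mulc ?Im_mulc /= mul0r ?addr0 ?subr0.
- exact: (Rintegral_affine (fun x => Re (f x))).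
- exact: (Rintegral_affine (fun x => Im (f x))).
Qed.

Lemma CInt_conv (f g : R -> C) : cexpdom f -> cexpdom g ->
  CInt setT (fun w => CInt setT (fun z => f (z + w) * g z)) = CInt setT f * CInt setT g.
Proof.
move=> [rf jf] [rg jg].
have h w : CInt setT (fun z => f (z + w) * g z) =
  (\int[mu]_z (Re (f (z + w)) * Re (g z)) - \int[mu]_z (Im (f (z + w)) * Im (g z)))
  +i* (\int[mu]_z (Re (f (z + w)) * Im (g z)) + \int[mu]_z (Im (f (z + w)) * Re (g z))).
  congr (_ +i* _).
  - under eq_Rintegral do rewrite Re_mulc.
    apply: RintegralB => //.
      exact: (integrable_convr (fun x => Re (f x)) (fun x => Re (g x))).
    exact: (integrable_convr (fun x => Im (f x)) (fun x => Im (g x))).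
  - under eq_Rintegral do rewrite Im_mulc.
    apply: RintegralD => //.
      exact: (integrable_convr (fun x => Re (f x)) (fun x => Im (g x))).
    exact: (integrable_convr (fun x => Im (f x)) (fun x => Re (g x))).
under eq_fun do rewrite h.
apply: complex_eq; rewrite ?Re_mulc ?Im_mulc /=.
- rewrite RintegralB //.
  + by rewrite (Rintegral_conv (fun x => Re (f x)) (fun x => Re (g x))) //
      (Rintegral_conv (fun x => Im (f x)) (fun x => Im (g x))).
  + exact: (integrable_conv (fun x => Re (f x)) (fun x => Re (g x))).
  + exact: (integrable_conv (fun x => Im (f x)) (fun x => Im (g x))).
- rewrite RintegralD //.
  + by rewrite (Rintegral_conv (fun x => Re (f x)) (fun x => Im (g x))) //
      (Rintegral_conv (fun x => Im (f x)) (fun x => Re (g x))).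
  + exact: (integrable_conv (fun x => Re (f x)) (fun x => Im (g x))).
  + exact: (integrable_conv (fun x => Im (f x)) (fun x => Re (g x))).
Qed.

End ComplexIntegrals.

(** * Gamma and Beta on the real line *)

Section GammaIntegral.
Import numFieldNormedType.Exports.
Local Open Scope classical_set_scope.
Context {R : realType}.
Local Notation C := R[i].
Local Notation Re := (@complex.Re R).
Local Notation Im := (@complex.Im R).

(** Integrands are written as [cexp] of an explicit phase, so that product identities become
    additive identities between phases. *)
Definition cexp (z : C) : C := (expR (Re z))%:C * cexpi (Im z).

Lemma cexpD (z w : C) : cexp (z + w) = cexp z * cexp w.
Proof.
case: z w => [a b] [c d]; rewrite /cexp /cexpi /= expRD cosD sinD.
by apply: complex_eq => /=; ring.
Qed.

Lemma Re_cexp (z : C) : Re (cexp z) = expR (Re z) * cos (Im z).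
Proof. by rewrite /cexp Re_mulc /= mul0r subr0. Qed.

Lemma Im_cexp (z : C) : Im (cexp z) = expR (Re z) * sin (Im z).
Proof. by rewrite /cexp Im_mulc /= mul0r addr0. Qed.

Lemma cexp_real (x : R) : cexp x%:C = (expR x)%:C.
Proof. by rewrite /cexp /cexpi /= cos0 sin0 mulr1. Qed.

Lemma cexpi_cexp (x : R) : cexpi x = cexp (0 +i* x).
Proof. by rewrite /cexp /= expR0 mul1r. Qed.

(** The modulus of [cexp (th x)] depends only on the real part of [th x], and sine and cosine are
    bounded by 1, so an upper bound on that real part suffices. *)
Lemma cexpdom_cexp (th : R -> C) (K m : R) :
  continuous (fun x => Re (th x)) -> continuous (fun x => Im (th x)) ->
  0 < m -> (forall x, Re (th x) <= K - m * `|x|) -> cexpdom (cexp \o th).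
Proof.
move=> cr ci m0 h.
have cE : continuous (fun x => expR (Re (th x))).
  move=> x; apply: (@continuous_comp _ _ _ (fun x => Re (th x)) expR);
    first exact: cr.
  exact: continuous_expR.
have b x (t : R) : `|t| <= 1 -> `|expR (Re (th x)) * t| <= expR K * expR (- (m * `|x|)).
  move=> t1; rewrite normrM ger0_norm ?expR_ge0 // -expRD.
  by rewrite (@le_trans _ _ (expR (Re (th x)))) ?ler_piMr ?expR_ge0 //
    ler_expR h.
split; split.
- under eq_fun do rewrite Re_cexp.
  move=> x; apply: cvgM; first exact: cE.
  by apply: (@continuous_comp _ _ _ (fun x => Im (th x)) cos);
    [exact: ci|exact: continuous_cos].
- by exists (expR K), m; split => // x; rewrite Re_cexp b // cos_max.
- under eq_fun do rewrite Im_cexp.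
  move=> x; apply: cvgM; first exact: cE.
  by apply: (@continuous_comp _ _ _ (fun x => Im (th x)) sin);
    [exact: ci|exact: continuous_sin].
- by exists (expR K), m; split => // x; rewrite Im_cexp b // sin_max.
Qed.

(* The exponent of the integrand of Gamma p after the substitution t = e^y. *)
Definition gphase (p : C) (y : R) : C := p * y%:C - (expR y)%:C.

Definition Gammaf (p : C) : R -> C := cexp \o gphase p.
Arguments Gammaf : simpl never.

Lemma Re_gphase p y : Re (gphase p y) = Re p * y - expR y.
Proof. by rewrite /gphase Re_subc Re_mulc /= mulr0 subr0. Qed.

Lemma Im_gphase p y : Im (gphase p y) = Im p * y.
Proof. by rewrite /gphase Im_subc Im_mulc /= mulr0 add0r subr0. Qed.

(** For negative [y] the term [Re p * y] gives the decay; for nonnegative [y] it comes from a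
    tangent line below the exponential. The rate [m] is the smaller of the two slopes [Re p] and
    1. *)
Lemma cexpdom_Gammaf (p : C) : 0 < Re p -> cexpdom (Gammaf p).
Proof.
move=> p0.
pose m := Num.min (Re p) 1.
pose c := ln (Re p + 1).
have m0 : 0 < m by rewrite lt_min p0 ltr01.
have m1 : m <= 1 by rewrite ge_min lexx orbT.
have mp : m <= Re p by rewrite ge_min lexx.
apply: (cexpdom_cexp _ `|(Re p + 1) * (c - 1)| m) => //.
- under eq_fun do rewrite Re_gphase.
  move=> x; apply: cvgB; last exact: continuous_expR.
  by apply: cvgMl_tmp; exact: cvg_id.
- under eq_fun do rewrite Im_gphase.
  by move=> x; apply: cvgMl_tmp; exact: cvg_id.
move=> y; rewrite Re_gphase.
(* The tangent to exp at [c] has slope [Re p + 1], one more than cancels [Re p * y], which leaves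
   [- y]. *)
have h1 : (Re p + 1) * (1 + (y - c)) <= expR y.
  have -> : expR y = (Re p + 1) * expR (y - c).
    by rewrite expRD expRN lnK ?posrE ?addr_gt0 // mulrC mulfVK // gt_eqF //
      addr_gt0.
  by rewrite ler_pM2l ?addr_gt0 // expR_ge1Dx.
have h2 := ler_norm ((Re p + 1) * (c - 1)).
have h3 := normr_ge0 ((Re p + 1) * (c - 1)).
have h4 := expR_ge0 y.
have [y0|y0] := leP 0 y.
  rewrite (ger0_norm y0).
  have h5 : m * y <= y by rewrite ler_piMl.
  lra.
rewrite (ltr0_norm y0).
have h5 : m * - y <= Re p * - y by rewrite ler_wpM2r // oppr_ge0 ltW.
lra.
Qed.

(** The substitution [t = e^y] contributes a factor [e^y], which raises the exponent [p - 1] to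
    [p]. *)
Lemma GammaE (p : C) : Gamma p = CInt setT (Gammaf p).
Proof.
rewrite /Gamma.
pose g (t : R) : C := cexp ((p - 1) * (ln t)%:C - t%:C).
have gE t : 0 < t -> cpowR t (p - 1) * (expR (- t))%:C = g t.
  move=> t0; rewrite /g cexpD -(cexp_real (- t)) rmorphN; congr (_ * _).
  rewrite /cpowR /cexp /powR gt_eqF //.
  congr ((expR _)%:C * cexpi _); first by rewrite Re_mulc /= mulr0 subr0.
  by rewrite Im_mulc /= mulr0 add0r mulrC.
have gexp y : g (expR y) * (expR y)%:C = Gammaf p y.
  rewrite -[X in g _ * X]cexp_real /g -cexpD expRK /Gammaf /= /gphase;
    congr cexp.
  by ring.
rewrite (@eq_CInt _ _ _ g); last first.
  by move=> t /=; rewrite in_itv /= andbT; exact: gE.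
have cln (t : R) : t \in `]0, +oo[%R -> {for t, continuous (@ln R)}.
  by rewrite in_itv /= andbT => t0; exact: continuous_ln.
have cE : {in `]0, +oo[%R, continuous (fun t => expR (Re (p - 1) * ln t - t))}.
  move=> t ht; apply: (@continuous_comp _ _ _ (fun t => Re (p - 1) * ln t - t) expR).
    by apply: cvgB; [apply: cvgMl_tmp; exact: cln|exact: cvg_id].
  exact: continuous_expR.
have reph (q : C) (x y : R) : Re (q * x%:C - y%:C) = Re q * x - y.
  by rewrite Re_subc Re_mulc /= mulr0 subr0.
have imph (q : C) (x y : R) : Im (q * x%:C - y%:C) = Im q * x.
  by rewrite Im_subc Im_mulc /= mulr0 add0r subr0.
have Rg t : Re (g t) = expR (Re (p - 1) * ln t - t) * cos (Im (p - 1) * ln t).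
  by rewrite Re_cexp reph imph.
have Ig t : Im (g t) = expR (Re (p - 1) * ln t - t) * sin (Im (p - 1) * ln t).
  by rewrite Im_cexp reph imph.
congr (_ +i* _).
- rewrite Rintegral_expR; last first.
    move=> t ht; under eq_fun do rewrite Rg.
    apply: cvgM; first exact: cE.
    apply: (@continuous_comp _ _ _ (fun t => Im (p - 1) * ln t) cos);
      last exact: continuous_cos.
    by apply: cvgMl_tmp; exact: cln.
  by apply: eq_Rintegral => y _; rewrite -gexp Re_mulc /= mulr0 subr0.
- rewrite Rintegral_expR; last first.
    move=> t ht; under eq_fun do rewrite Ig.
    apply: cvgM; first exact: cE.
    apply: (@continuous_comp _ _ _ (fun t => Im (p - 1) * ln t) sin);
      last exact: continuous_sin.
    by apply: cvgMl_tmp; exact: cln.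
  by apply: eq_Rintegral => y _; rewrite -gexp Im_mulc /= mulr0 add0r mulrC.
Qed.

Lemma Gammaf_shift1 (p : C) y : Gammaf (p + 1) y = (expR y)%:C * Gammaf p y.
Proof.
rewrite -cexp_real /Gammaf /= -cexpD; congr cexp; rewrite /gphase; ring.
Qed.

Lemma GammafRe (p : C) y :
  Re (Gammaf p y) = expR (Re p * y - expR y) * cos (Im p * y).
Proof. by rewrite Re_cexp Re_gphase Im_gphase. Qed.

Lemma GammafIm (p : C) y :
  Im (Gammaf p y) = expR (Re p * y - expR y) * sin (Im p * y).
Proof. by rewrite Im_cexp Re_gphase Im_gphase. Qed.

Let e (s y : R) := expR (s * y - expR y).

(** With [p = s + i t] the derivative is the real part of [p * Gammaf p y - Gammaf (p + 1) y]; the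
    sine version below is the imaginary part. *)
Lemma is_derive_expR_cos (s t y : R) :
  is_derive y (1 : R) (fun y : R => expR (s * y - expR y) * cos (t * y))
    (s * (e s y * cos (t * y)) - t * (e s y * sin (t * y))
     - expR y * (e s y * cos (t * y))).
Proof. by apply: is_derive_eq; rewrite /e /GRing.scale /=; ring. Qed.

Lemma is_derive_expR_sin (s t y : R) :
  is_derive y (1 : R) (fun y : R => expR (s * y - expR y) * sin (t * y))
    (s * (e s y * sin (t * y)) + t * (e s y * cos (t * y))
     - expR y * (e s y * sin (t * y))).
Proof. by apply: is_derive_eq; rewrite /e /GRing.scale /=; ring. Qed.

(** Integration by parts: [p * Gammaf p - Gammaf (p + 1)] is the derivative of [Gammaf p], which
    decays at both ends. *)
Lemma Gamma_add1 (p : C) : 0 < Re p -> Gamma (p + 1) = p * Gamma p.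
Proof.
move=> p0; rewrite !GammaE.
have p10 : 0 < Re (p + 1) by rewrite raddfD /= addr_gt0.
have dp := cexpdom_Gammaf _ p0; have dp1 := cexpdom_Gammaf _ p10.
have [rp jp] := cexpdom_cintegrable _ dp.
have [rp1 jp1] := cexpdom_cintegrable _ dp1.
have [[cr [Kr [mr [mr0 hr]]]] [cj [Kj [mj [mj0 hj]]]]] := dp.
have [[cr1 _] [cj1 _]] := dp1.
rewrite -CIntZ; last by split.
have er : (fun y => Re (p * Gammaf p y) - Re (Gammaf (p + 1) y)) =
          (fun y => Re p * Re (Gammaf p y) - Im p * Im (Gammaf p y) - Re (Gammaf (p + 1) y)).
  by apply/funext => y; rewrite Re_mulc.
have ej : (fun y => Im (p * Gammaf p y) - Im (Gammaf (p + 1) y)) =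
          (fun y => Re p * Im (Gammaf p y) + Im p * Re (Gammaf p y) - Im (Gammaf (p + 1) y)).
  by apply/funext => y; rewrite Im_mulc.
have [ir ij] : cintegrable (fun y => p * Gammaf p y) by apply: cintegrableZ;
  split.
apply: complex_eq; apply/esym/eqP; rewrite -subr_eq0 /=.
- rewrite -Rintegral_setTB // er; apply/eqP.
  apply: (Rintegral_derive_eq0 (fun y => Re (Gammaf p y)) _ Kr mr) => //.
  + move=> y; under eq_fun do rewrite GammafRe.
    rewrite Gammaf_shift1 Re_mulc GammafRe GammafIm /= mul0r subr0.
    exact: is_derive_expR_cos.
  + move=> y; apply: cvgB; last exact: cr1.
    by apply: cvgB; apply: cvgMl_tmp; [exact: cr|exact: cj].
  + by rewrite -er; exact: integrable_EFinB.
- rewrite -Rintegral_setTB // ej; apply/eqP.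
  apply: (Rintegral_derive_eq0 (fun y => Im (Gammaf p y)) _ Kj mj) => //.
  + move=> y; under eq_fun do rewrite GammafIm.
    rewrite Gammaf_shift1 Im_mulc GammafRe GammafIm /= mul0r addr0.
    exact: is_derive_expR_sin.
  + move=> y; apply: cvgB; last exact: cj1.
    by apply: cvgD; apply: cvgMl_tmp; [exact: cj|exact: cr].
  + by rewrite -ej; exact: integrable_EFinB.
Qed.

End GammaIntegral.

(** * Nonvanishing of Gamma at positive reals and the Beta integral *)

Section BetaIntegral.
Import numFieldNormedType.Exports.
Local Open Scope classical_set_scope.
Context {R : realType}.
Local Notation C := R[i].
Local Notation mu := (@lebesgue_measure R).
Local Notation integrable f := (integrable mu setT (EFin \o f)).
Local Notation Re := (@complex.Re R).
Local Notation Im := (@complex.Im R).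

Lemma Rintegral_gt0 (f : R -> R) (a b c : R) : integrable f ->
  (forall x, 0 <= f x) -> a < b -> 0 < c ->
  (forall x, a <= x <= b -> c <= f x) -> 0 < \int[mu]_x f x.
Proof.
move=> fi f0 ab c0 fc.
have mD : measurable (`[a, b] : set R) by [].
have fD : mu.-integrable `[a, b] (EFin \o f) by exact: integrableS fi.
have mab : mu (`[a, b]%classic : set R) = (b - a)%:E.
  by rewrite lebesgue_measure_itv /= lte_fin ab -EFinB.
have ic : mu.-integrable `[a, b] (EFin \o cst c).
  apply: le_integrable fD => //; first exact/measurable_EFinP.
  move=> x; rewrite /= in_itv /= => /fc cf.
  by rewrite lee_fin !ger0_norm // ltW.
apply: (@lt_le_trans _ _ (\int[mu]_(x in `[a, b]) c)).
  have -> : \int[mu]_(x in `[a, b]) c = c * fine (mu (`[a, b]%classic : set R)).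
    exact: Rintegral_cst.
  by rewrite mab mulr_gt0 //= subr_gt0.
apply: (@le_trans _ _ (\int[mu]_(x in `[a, b]) f x)).
  exact: le_Rintegral.
apply: fine_le.
- exact: (integrable_fin_num _ fD).
- exact: (integrable_fin_num _ fi).
apply: ge0_subset_integral => //; first exact: measurable_int fi.
by move=> x _; rewrite /= lee_fin.
Qed.

Lemma Gamma_real (s : R) : Gamma s%:C = (\int[mu]_y expR (s * y - expR y))%:C.
Proof.
rewrite GammaE -[RHS]complexr0; congr (_ +i* _).
  by apply: eq_Rintegral => y _; rewrite GammafRe /= mul0r cos0 mulr1.
under eq_Rintegral do rewrite GammafIm /= mul0r sin0 mulr0.
by rewrite Rintegral_cst // mul0r.
Qed.

(** The integrand is nonnegative, and at least [expR (- expR 1)] on [[0, 1]]. Real arguments suffice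
    for the later divisions, where [p + q = 2 A] is real. *)
Lemma Gamma_real_neq0 (s : R) : 0 < s -> Gamma (s%:C : C) != 0.
Proof.
move=> s0; rewrite Gamma_real -(rmorph0 (real_complex R)) (inj_eq (@complexI R)).
have : integrable (fun y => expR (s * y - expR y)).
  have [+ _] := cexpdom_cintegrable _ (cexpdom_Gammaf s%:C s0).
  by under eq_fun do rewrite GammafRe /= mul0r cos0 mulr1.
move=> h; apply: lt0r_neq0.
apply: (Rintegral_gt0 _ 0 1 (expR (- expR 1)) h).
- by move=> x; exact: expR_ge0.
- exact: ltr01.
- exact: expR_gt0.
move=> x /andP[x0 x1]; rewrite ler_expR.
have h1 : expR x <= expR 1 by rewrite ler_expR.
have h2 : 0 <= s * x by rewrite mulr_ge0 // ltW.
lra.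
Qed.

Lemma Gamma_addn (p : C) (n : nat) : 0 < Re p ->
  Gamma (p + n%:R) = pochhammer p n * Gamma p.
Proof.
move=> p0; elim: n => [|n IH].
  by rewrite addr0 /pochhammer big_ord0 mul1r.
rewrite -natr1 addrA Gamma_add1; last first.
  by rewrite raddfD /= -(rmorph_nat (real_complex R)) /= ltr_wpDr.
by rewrite IH /pochhammer big_ord_recr /= mulrA [_ * (p + _)]mulrC.
Qed.

(** Euler's integrand [t^p (1 - t)^q] in the coordinate [t = 1 / (1 + e^w)], for which the measure
    [dt / (t (1 - t))] becomes [dw]. *)
Definition betaf (p q : C) (w : R) : C :=
  cexp (q * w%:C - (p + q) * (ln (1 + expR w))%:C).

(** The quantity [ln (1 + expR w)] dominates both [w] and 0; the first bound gives decay at rate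
    [Re p] for [w >= 0], the second at rate [Re q] for [w < 0]. *)
Lemma cexpdom_betaf (p q : C) : 0 < Re p -> 0 < Re q -> cexpdom (betaf p q).
Proof.
move=> p0 q0.
have cL : continuous (fun w : R => ln (1 + expR w)).
  move=> w; apply: (@continuous_comp _ _ _ (fun w => 1 + expR w) (@ln R)).
    by apply: cvgD; [exact: cvg_cst|exact: continuous_expR].
  by apply: continuous_ln; rewrite addr_gt0 // expR_gt0.
have rE w : Re (q * w%:C - (p + q) * (ln (1 + expR w))%:C) =
    Re q * w - (Re p + Re q) * ln (1 + expR w).
  by rewrite Re_subc !Re_mulc Re_addc /= !mulr0 !subr0.
have iE w : Im (q * w%:C - (p + q) * (ln (1 + expR w))%:C) =
    Im q * w - (Im p + Im q) * ln (1 + expR w).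
  by rewrite Im_subc !Im_mulc Im_addc /= !mulr0 !add0r.
pose m := Num.min (Re p) (Re q).
have m0 : 0 < m by rewrite lt_min p0 q0.
apply: (cexpdom_cexp (fun w => q * w%:C - (p + q) * (ln (1 + expR w))%:C) 0 m) => //.
- under eq_fun do rewrite rE.
  by move=> x; apply: cvgB; apply: cvgMl_tmp; [exact: cvg_id|exact: cL].
- under eq_fun do rewrite iE.
  by move=> x; apply: cvgB; apply: cvgMl_tmp; [exact: cvg_id|exact: cL].
move=> w; rewrite rE.
have L0 : 0 <= ln (1 + expR w) by rewrite ln_ge0 // lerDl expR_ge0.
have Lw : w <= ln (1 + expR w).
  by rewrite -[X in X <= _]expRK ler_ln ?posrE ?addr_gt0 ?expR_gt0 // lerDr.
have mp : m <= Re p by rewrite ge_min lexx.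
have mq : m <= Re q by rewrite ge_min lexx orbT.
have pq0 : 0 <= Re p + Re q by rewrite addr_ge0 // ltW.
have h1 := ler_wpM2l pq0 Lw.
have h2 := mulr_ge0 pq0 L0.
have [w0|w0] := leP 0 w.
  rewrite (ger0_norm w0).
  have h3 := ler_wpM2r w0 mp; lra.
rewrite (ltr0_norm w0).
have w0' : 0 <= - w by rewrite oppr_ge0 ltW.
have h3 := ler_wpM2r w0' mq; lra.
Qed.

(** The two double exponentials merge because [e^z + e^(z + w) = e^z (1 + e^w)], and the factor
    [1 + e^w] is absorbed as a translation of [z]. *)
Lemma Gammaf_conv (p q : C) (z w : R) :
  Gammaf q (z + w) * Gammaf p z =
  betaf p q w * Gammaf (p + q) (z + ln (1 + expR w)).
Proof.
rewrite /Gammaf /betaf /= -!cexpD; congr cexp; rewrite /gphase.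
rewrite [expR (z + ln _)]expRD lnK ?posrE ?addr_gt0 ?expR_gt0 //.
rewrite mulrDr mulr1 -expRD !rmorphD /=; ring.
Qed.

Lemma CInt_betaf (p q : C) : 0 < Re p -> 0 < Re q ->
  Gamma p * Gamma q = Gamma (p + q) * CInt setT (betaf p q).
Proof.
move=> p0 q0.
have pq0 : 0 < Re (p + q) by rewrite raddfD addr_gt0.
have dpq := cexpdom_Gammaf _ pq0.
rewrite mulrC [Gamma p]GammaE [Gamma q]GammaE -CInt_conv; last 2 first.
- exact: cexpdom_Gammaf.
- exact: cexpdom_Gammaf.
rewrite -CIntZ; last exact/cexpdom_cintegrable/cexpdom_betaf.
apply: eq_CInt => w _.
under eq_fun do rewrite Gammaf_conv.
have h := cexpdom_cintegrable_affine _ 1 (ln (1 + expR w)) ltr01 dpq.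
rewrite CIntZ; last first.
  by move: h; under eq_fun do rewrite mul1r.
rewrite mulrC GammaE; congr (_ * _).
(* For fixed [w] the shift of [z] does not change the integral, so the inner integral is
   [Gamma (p + q)] for every [w]. *)
rewrite (CInt_affine _ 1 (ln (1 + expR w)) ltr01 dpq) mul1r.
by under [in RHS]eq_fun do rewrite mul1r.
Qed.

End BetaIntegral.

(** * The one-dimensional transform *)

Section Hypergeometric.
Import numFieldNormedType.Exports.
Local Open Scope classical_set_scope.
Context {R : realType}.
Local Notation C := R[i].
Local Notation Re := (@complex.Re R).

Lemma climn_eventually (u : nat -> C) (c : C) (N : nat) :
  (forall n, (N <= n)%N -> u n = c) -> climn u = c.
Proof.
move=> h; apply: complex_eq; rewrite /climn /=; apply: lim_near_cst => //;
  near=> n; rewrite h //; near: n; exact: nbhs_infty_ge.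
Unshelve. all: by end_near. Qed.

Lemma pochhammer_oppn (n k : nat) : (n < k)%N -> pochhammer (- n%:R : C) k = 0.
Proof.
move=> nk; rewrite /pochhammer (bigD1 (Ordinal nk)) //=.
by rewrite addNr mul0r.
Qed.

Definition pFq_term (as_ bs : seq C) (x : C) (k : nat) : C :=
  (\prod_(a <- as_) pochhammer a k) / (\prod_(b <- bs) pochhammer b k)
    * x ^+ k / (k`!)%:R.

(** The factor [pochhammer (- n%:R) k] vanishes for [k > n], so the partial sums are constant from
    [n + 1] terms on. *)
Lemma pFq_oppn (n : nat) (as_ bs : seq C) (x : C) :
  pFq (- n%:R :: as_) bs x = \sum_(k < n.+1) pFq_term (- n%:R :: as_) bs x k.
Proof.
apply: (climn_eventually _ _ n.+1) => N nN.
set t := pFq_term (- n%:R :: as_) bs x.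
have t0 k : (n < k)%N -> t k = 0.
  by move=> nk; rewrite /t /pFq_term big_cons pochhammer_oppn // !mul0r.
suff : \sum_(0 <= k < N) t k = \sum_(0 <= k < n.+1) t k by rewrite !big_mkord.
rewrite (big_cat_nat (n := n.+1)) //= [X in _ + X]big_nat.
by rewrite [X in _ + X]big1 ?addr0 // => k /andP[nk _]; exact: t0.
Qed.

(** The value is [4 e^(2x) / (1 + e^(2x))^2]; in exponential form, a real power of it only
    multiplies the exponent. *)
Lemma onem_tanh2 (x : R) :
  1 - tanh x ^+ 2 = expR (ln 4 + (2 * x - 2 * ln (1 + expR (2 * x)))).
Proof.
have h := expR_gt0 x.
rewrite expRD lnK ?posrE // expRD expRN.
rewrite !expRM_natl lnK ?posrE ?addr_gt0 ?exprn_gt0 // /tanh expRN.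
have h0 : expR x != 0 by rewrite gt_eqF.
have h1 : 1 + expR x ^+ 2 != 0 by rewrite gt_eqF // addr_gt0 // exprn_gt0.
by field; rewrite h0 h1.
Qed.

Lemma onem_tanh_half (x : R) :
  (1 - tanh x) / 2 = expR (- ln (1 + expR (2 * x))).
Proof.
have h := expR_gt0 x.
rewrite expRN lnK ?posrE ?addr_gt0 ?expR_gt0 //.
rewrite /tanh expRN expRM_natl.
have h0 : expR x != 0 by rewrite gt_eqF.
have h1 : 1 + expR x ^+ 2 != 0 by rewrite gt_eqF // addr_gt0 // exprn_gt0.
by field; rewrite h0 h1.
Qed.

(** At [w = 2 x] the term [q * w] produces the phase [- i s x], while [p + q = 2 A] is real; the
    power of [(1 - tanh x) / 2] only adds [k] to [p]. The form [2 * x + 0] fits the affine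
    substitution rule. *)
Lemma betaf_tanh (A s x : R) (k : nat) :
  cexpi (- (s * x)) * (powR (1 - tanh x ^+ 2) A)%:C * ((1 - tanh x) / 2)%:C ^+ k =
  (powR 4 A)%:C * betaf ((A +i* (s / 2)) + k%:R) (A +i* (- s / 2)) (2 * x + 0).
Proof.
rewrite onem_tanh2 onem_tanh_half -[_%:C ^+ k]rmorphXn /= -expRM_natl.
rewrite /powR !gt_eqF ?expR_gt0 // expRK cexpi_cexp /betaf addr0.
rewrite -!cexp_real -!cexpD; congr cexp.
rewrite -(rmorph_nat (real_complex R)).
by apply: complex_eq => /=; field.
Qed.

(** Raising [p] by [k] multiplies [Gamma p] by [pochhammer p k] and [Gamma (p + q)] by
    [pochhammer (2 * A)%:C k]; the factor [2^-1] is the Jacobian of [w = 2 x]. *)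
Lemma CInt_betaf_addn (A s : R) (k : nat) : 0 < A ->
  let p := A +i* (s / 2) in let q := A +i* (- s / 2) in
  CInt setT (fun x : R => betaf (p + k%:R) q (2 * x + 0)) =
  2^-1 * (Beta p q * pochhammer p k / pochhammer (2 * A)%:C k).
Proof.
move=> A0 p q.
have p0 : 0 < Re p by [].
have q0 : 0 < Re q by [].
have pk0 : 0 < Re (p + k%:R).
  by rewrite Re_addc -(rmorph_nat (real_complex R)) /= ltr_wpDr.
have pqE : p + q = (2 * A)%:C by apply: complex_eq => /=; field.
have h := CInt_betaf _ _ pk0 q0.
have h2 := CInt_affine _ 2 0 (ltr0n _ 2) (cexpdom_betaf _ _ pk0 q0).
have A20 : 0 < 2 * A by rewrite mulr_gt0.
have g0 : Gamma (p + q) != 0 by rewrite pqE Gamma_real_neq0.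
have pqk : p + k%:R + q = p + q + k%:R by ring.
have gk0 : Gamma (p + q + k%:R) != 0.
  rewrite pqE -(rmorph_nat (real_complex R)) -rmorphD /= Gamma_real_neq0 //.
  by rewrite ltr_wpDr.
have gE : Gamma (p + q + k%:R) = pochhammer (2 * A)%:C k * Gamma (p + q).
  by rewrite Gamma_addn pqE.
have po0 : pochhammer (2 * A)%:C k != 0.
  by move: gk0; rewrite gE mulf_eq0 negb_or => /andP[].
move: h; rewrite h2 pqk gE Gamma_addn // => h.
have c2 : (2%:C : C) = 2 by rewrite rmorph_nat.
move: h; rewrite c2 /Beta; set I := CInt _ _ => h.
have -> : I = (pochhammer p k * Gamma p * Gamma q) / (pochhammer (2 * A)%:C k * Gamma (p + q) * 2).
  by rewrite h; field; rewrite g0 po0.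
by field; rewrite g0 po0.
Qed.

End Hypergeometric.

Section Transform.
Import numFieldNormedType.Exports.
Local Open Scope classical_set_scope.
Context {R : realType}.
Local Notation C := R[i].
Local Notation Re := (@complex.Re R).

(** * Transform of a single Gegenbauer factor *)

Section OneVariable.
Context (n : nat) (A lam s : R) (A0 : 0 < A).

Definition gegen_wave (x : R) : C :=
  cexpi (- (s * x)) *
  ((powR (1 - tanh x ^+ 2) A)%:C * Gegenbauer n lam (tanh x)).

Let p : C := A +i* (s / 2).
Let q : C := A +i* (- s / 2).
Let c : C := (pochhammer (2 * lam) n / (n`!)%:R)%:C.
Let t (k : nat) : C :=
  pochhammer (- n%:R) k * pochhammer (n%:R + 2 * lam)%:C k
    / pochhammer (lam + 2^-1)%:C k / (k`!)%:R.

Let gegen_waveE : gegen_wave = (fun x => \sum_(k < n.+1)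
  (c * t k * (powR 4 A)%:C) * betaf (p + k%:R) q (2 * x + 0)).
Proof.
apply/funext => x; rewrite /gegen_wave /Gegenbauer -/c.
rewrite (_ : - (n%:R)%:C = - n%:R :> C); last by rewrite rmorph_nat.
rewrite pFq_oppn !mulr_sumr; apply: eq_bigr => k _.
rewrite -[RHS]mulrA -betaf_tanh /pFq_term !big_cons !big_nil !mulr1 /t.
by ring.
Qed.

Let p0 k : 0 < Re (p + k%:R).
Proof. by rewrite Re_addc -(rmorph_nat (real_complex R)) /= ltr_wpDr. Qed.

Let betaf_integrable k : cintegrable (fun x => betaf (p + k%:R) q (2 * x + 0)).
Proof. by apply: cexpdom_cintegrable_affine => //; exact: cexpdom_betaf. Qed.

Lemma cintegrable_gegen_wave : cintegrable gegen_wave.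
Proof.
rewrite gegen_waveE; apply: (cintegrable_sum _ (fun k x => c * t k * (powR 4 A)%:C *
  betaf (p + k%:R) q (2 * x + 0))) => k _.
exact: cintegrableZ.
Qed.

(** Termwise integration attaches [(p)_k / (2 A)_k] to the coefficient [t k], and this extra pair of
    parameters promotes the 2F1 to a 3F2. *)
Lemma CInt_gegen_wave : CInt setT gegen_wave =
  (powR 2 (2 * A - 1))%:C * (c * (Beta p q *
    pFq [:: - n%:R; (n%:R + 2 * lam)%:C; p] [:: (lam + 2^-1)%:C;
      (2 * A)%:C] 1)).
Proof.
rewrite gegen_waveE (CInt_sum _ (fun k x => c * t k * (powR 4 A)%:C *
  betaf (p + k%:R) q (2 * x + 0))); last by move=> k _; exact: cintegrableZ.
rewrite pFq_oppn !mulr_sumr; apply: eq_bigr => k _.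
rewrite CIntZ // CInt_betaf_addn //
  -/p -/q /pFq_term !big_cons !big_nil !mulr1 expr1n /t.
(* The factor [4^A] comes from [1 - tanh x ^+ 2], the half from [w = 2 x]. *)
have -> : (powR 2 (2 * A - 1))%:C = (powR 4 A)%:C * 2^-1 :> C.
  rewrite powRD ?pnatr_eq0 ?implybT // powRrM powR_mulrn // -natrX.
  by rewrite powR_inv1 // rmorphM fmorphV rmorph_nat.
rewrite invfM; ring.
Qed.

End OneVariable.

(** * Iterated integrals of products and separation of the variables *)

Lemma eq_iint (k : nat) (F G : (nat -> R) -> C) : F =1 G -> iint k F = iint k G.
Proof. by move=> /funext ->. Qed.

(** The constant [c] is general because the inner integrals, with the outermost variable fixed at
    [t], see [g r.+1 t] as part of it. *)
Lemma iint_prod (r : nat) (g : nat -> R -> C) (c : C) :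
  (forall j, (1 <= j <= r)%N -> cintegrable (g j)) ->
  iint r (fun x => c * \prod_(1 <= j < r.+1) g j (x j)) =
  c * \prod_(1 <= j < r.+1) CInt setT (g j).
Proof.
elim: r c => [|r IH] c gi; first by rewrite /= !big_geq.
rewrite /=.
transitivity (CInt setT (fun t => (c * \prod_(1 <= j < r.+1) CInt setT (g j)) * g r.+1 t)).
  apply: eq_CInt => t _.
  rewrite (eq_iint _ _ (fun y => (c * g r.+1 t) * \prod_(1 <= j < r.+1) g j (y j))).
    rewrite IH; first by ring.
    by move=> j /andP[j1 jr]; apply: gi; rewrite j1 leqW.
  move=> y; rewrite big_nat_recr //= eqxx [X in _ * X]mulrC mulrA;
    congr (_ * _).
  apply: eq_big_nat => j /andP[_ jr].
  by rewrite ltn_eqF.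
rewrite CIntZ; last by apply: gi; rewrite ltnS leqnn.
by rewrite [in RHS]big_nat_recr //= mulrA.
Qed.

Lemma onem_tanh2_gt0 (x : R) : 0 < 1 - tanh x ^+ 2.
Proof. by rewrite onem_tanh2 expR_gt0. Qed.

Section Factorization.
Context (x : nat -> R).
Let w j := 1 - tanh (x j) ^+ 2.
Let T k := \prod_(1 <= i < k.+1) w i.

Let T_gt0 k : 0 < T k.
Proof. by apply: prodr_gt0 => i _; exact: onem_tanh2_gt0. Qed.

(** Induction: the square of the next [upsilon] is [T k] times a squared [tanh], and subtracting it
    from [T k] leaves the next product. *)
Lemma onem_sqnorm_upsilon k :
  1 - sqnorm_pre (upsilon x) k = \prod_(1 <= i < k.+1) (1 - tanh (x i) ^+ 2).
Proof.
elim: k => [|k IH]; first by rewrite /sqnorm_pre !big_geq // subr0.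
rewrite /sqnorm_pre [X in 1 - X]big_nat_recr //= [in RHS]big_nat_recr //=.
rewrite opprD addrA -/(sqnorm_pre _ k) IH.
rewrite /upsilon exprMn sqr_sqrtr; last exact/ltW/T_gt0.
by rewrite mulrBr mulr1 mulrC.
Qed.

Lemma powR_prod_nat (k : nat) (a : R) :
  powR (T k) a = \prod_(1 <= i < k.+1) powR (w i) a.
Proof.
elim: k => [|k IH]; first by rewrite /T !big_geq // powR1.
rewrite /T [in RHS]big_nat_recr //= [in LHS]big_nat_recr //= powRM ?IH //.
  exact/ltW/T_gt0.
exact/ltW/onem_tanh2_gt0.
Qed.

Lemma nsufS (r : nat) (n : nat -> nat) (j : nat) : (j <= r.+1)%N ->
  nsuf r.+1 n j = (nsuf r n j + n r.+1)%N.
Proof. by move=> jr; rewrite /nsuf big_nat_recr. Qed.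

(** Exchange of a double product: [w i] occurs with exponent [n_j / 2] for every [j > i], and these
    add up to [|n^(i+1)| / 2]. *)
Lemma prod_powR_nsuf (r : nat) (n : nat -> nat) :
  \prod_(1 <= j < r.+1) powR (T j.-1) ((n j)%:R / 2) =
  \prod_(1 <= j < r.+1) powR (w j) ((nsuf r n j.+1)%:R / 2).
Proof.
elim: r => [|r IH]; first by rewrite !big_geq.
rewrite big_nat_recr //= IH [in RHS]big_nat_recr //=.
(* The suffix beyond the last index is empty, so the newest weight has exponent 0; the new factor in
   [T r] raises every earlier suffix by [n r.+1]. *)
rewrite [X in powR (w r.+1) (X%:R / 2)](_ : _ = 0%N);
  last by rewrite /nsuf big_geq.
rewrite mul0r powRr0 mulr1 powR_prod_nat -big_split /=.
apply: eq_big_nat => j /andP[_ jr].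
rewrite nsufS // natrD mulrDl powRD //.
by rewrite lt0r_neq0 ?implybT // onem_tanh2_gt0.
Qed.

Lemma ballP_upsilon (r : nat) (mu : R) (n : nat -> nat) :
  ballP r mu n (upsilon x) =
  \prod_(1 <= j < r.+1) ((powR (w j) ((nsuf r n j.+1)%:R / 2))%:C *
     Gegenbauer (n j) (ball_lambda r mu n j) (tanh (x j))).
Proof.
have split (F G : nat -> C) : \prod_(1 <= j < r.+1) (F j * G j) =
    (\prod_(1 <= j < r.+1) F j) * (\prod_(1 <= j < r.+1) G j) by exact: big_split.
rewrite /ballP [LHS]split [RHS]split; apply: f_equal2.
  rewrite -[RHS](rmorph_prod (real_complex R)) -prod_powR_nsuf.
  rewrite (rmorph_prod (real_complex R)).
  by apply: eq_bigr => j _; rewrite onem_sqnorm_upsilon.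
(* The denominator is the square root contained in [upsilon]; it is positive and cancels, leaving
   [tanh (x j)]. *)
apply: eq_big_nat => j /andP[j0 _]; apply: f_equal.
rewrite onem_sqnorm_upsilon prednK // /upsilon mulfK // sqrtr_eq0 -ltNge.
by rewrite -(prednK j0); exact: T_gt0.
Qed.

Lemma cexpi_sum (s e : nat) (f : nat -> R) :
  cexpi (\sum_(s <= j < e) f j) = \prod_(s <= j < e) cexpi (f j) :> C.
Proof.
apply: (big_morph (@cexpi R)) => [a b|].
  rewrite !cexpi_cexp -cexpD; congr cexp.
  by apply: complex_eq => /=; rewrite ?addr0.
by rewrite /cexpi cos0 sin0.
Qed.

Definition exponent (r : nat) (n : nat -> nat) (a : R) (j : nat) : R :=
  a + (nsuf r n j.+1)%:R / 2 + (r%:R - j%:R) / 4.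

(** The exponents [a + (r - j) / 4] from [f_r] and [|n^(j+1)| / 2] from the ball polynomial add up
    to [exponent]. The leading [1] is the constant of [iint_prod]. *)
Lemma wave_f_r (r : nat) (n : nat -> nat) (a mu : R) (xi : nat -> R) :
  cexpi (- \sum_(1 <= j < r.+1) xi j * x j) * f_r r n a mu x =
  1 * \prod_(1 <= j < r.+1)
    gegen_wave (n j) (exponent r n a j) (ball_lambda r mu n j) (xi j) (x j).
Proof.
rewrite mul1r /f_r ballP_upsilon -sumrN cexpi_sum (rmorph_prod (real_complex R)).
rewrite -!big_split /=; apply: eq_bigr => j _.
rewrite /gegen_wave; congr (_ * _); rewrite mulrA -rmorphM; congr (_%:C * _).
rewrite -powRD; last by rewrite lt0r_neq0 ?implybT // onem_tanh2_gt0.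
by congr powR; rewrite /exponent; ring.
Qed.

End Factorization.

End Transform.

(** * Constants *)

Section Constants.
Import numFieldNormedType.Exports.
Local Open Scope classical_set_scope.
Context {R : realType}.
Local Notation C := R[i].

(** Each [n_k] is counted once for every [j] with [1 <= j < k], hence [k - 1] times. *)
Lemma sum_nsuf (r : nat) (n : nat -> nat) :
  (\sum_(1 <= j < r.+1) nsuf r n j.+1 = \sum_(1 <= j < r) j * n j.+1)%N.
Proof.
elim: r => [|r IH]; first by rewrite !big_geq.
rewrite big_nat_recr //= [X in (_ + X)%N](_ : _ = 0%N);
  last by rewrite /nsuf big_geq.
rewrite addn0 (eq_big_nat _ _ (F2 := fun j => (nsuf r n j.+1 + n r.+1)%N));
  last first.
  by move=> j /andP[_ jr]; rewrite nsufS.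
rewrite big_split /= IH sum_nat_const_nat subn1 /=.
case: r {IH} => [|r]; first by rewrite !big_geq.
by rewrite [in RHS]big_nat_recr.
Qed.

(** The upper limit [m] is kept apart from the [r] in the summand, so that induction can run on [m]
    alone. *)
Lemma sum_subn (r m : nat) :
  \sum_(1 <= j < m.+1) (r%:R - j%:R : R) = m%:R * r%:R - m%:R * (m%:R + 1) / 2.
Proof.
elim: m => [|m IH]; first by rewrite big_geq // !mul0r subr0.
by rewrite big_nat_recr //= IH -natr1; field.
Qed.

(** Collects the powers of 2 of the one-dimensional transforms; the parts free of [a] and [n] give
    [- r + r (r - 1) / 4 = r (r - 5) / 4]. *)
Lemma sum_exponent (r : nat) (n : nat -> nat) (a : R) :
  \sum_(1 <= j < r.+1) (2 * exponent r n a j - 1) =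
  2 * r%:R * a + r%:R * (r%:R - 5) / 4 + (\sum_(1 <= j < r) (j * n j.+1)%N)%:R.
Proof.
rewrite -sum_nsuf natr_sum.
have E j : 2 * exponent r n a j - 1 =
    (2 * a - 1) + 2^-1 * (r%:R - j%:R) + (nsuf r n j.+1)%:R.
  by rewrite /exponent; field.
rewrite (eq_bigr _ (fun j _ => E j)).
rewrite big_split big_split /= -mulr_sumr sum_subn sumr_const_nat subn1 /= -[_ *+ r]mulr_natl.
by congr (_ + _); field.
Qed.

Lemma prod_powR2 (r : nat) (f : nat -> R) :
  \prod_(1 <= j < r) powR 2 (f j) = powR 2 (\sum_(1 <= j < r) f j).
Proof.
apply/esym; apply: (big_morph (powR 2)) => [x y|].
  by rewrite powRD // pnatr_eq0 implybT.
by rewrite powRr0.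
Qed.

Lemma exponent_gt0 (r : nat) (n : nat -> nat) (a : R) (j : nat) :
  0 < a -> (j <= r)%N -> 0 < exponent r n a j.
Proof.
move=> a0 jr; have h : (j%:R : R) <= r%:R by rewrite ler_nat.
have h2 : 0 <= (nsuf r n j.+1)%:R :> R by rewrite ler0n.
rewrite /exponent; lra.
Qed.

Lemma ThetaE (r : nat) (a mu : R) (n : nat -> nat) (j : nat) (s : R) :
  Theta r a mu n j s =
  Beta (exponent r n a j +i* (s / 2)) (exponent r n a j +i* (- s / 2)) *
  pFq [:: - (n j)%:R; ((n j)%:R + 2 * ball_lambda r mu n j)%:C;
          exponent r n a j +i* (s / 2)]
      [:: (ball_lambda r mu n j + 2^-1)%:C; (2 * exponent r n a j)%:C] 1.
Proof.
rewrite /Theta; cbv zeta.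
have -> : (n j)%:R + 2 * ((nsuf r n j.+1)%:R + mu + (r%:R - j%:R) / 2) =
    (n j)%:R + 2 * ball_lambda r mu n j :> R by rewrite /ball_lambda; ring.
have -> : (nsuf r n j.+1)%:R + mu + (r%:R - j%:R + 1) / 2 =
    ball_lambda r mu n j + 2^-1 :> R by rewrite /ball_lambda; field.
have -> : (nsuf r n j.+1)%:R + 2 * a + (r%:R - j%:R) / 2 =
    2 * exponent r n a j :> R by rewrite /exponent; field.
by rewrite rmorph_nat.
Qed.

Lemma pochhammer_real (x : R) (n : nat) :
  pochhammer x%:C n = (pochhammer x n)%:C :> C.
Proof.
rewrite /pochhammer (rmorph_prod (real_complex R)); apply: eq_bigr => i _.
by rewrite rmorphD /= rmorph_nat.
Qed.

End Constants.

(** * Assembly of the transform and its continuous Hahn form *)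

Theorem theorem3p2 (R : realType) (r : nat) (a mu : R) (n : nat -> nat) :
  (1 <= r)%N ->
  0 < a ->
  (forall j, (1 <= j <= r)%N -> forall i, (i < n j)%N ->
     (nsuf r n j.+1)%:R + mu + (r%:R - j%:R + 1) / 2 + i%:R != 0) ->
  forall xi : nat -> R,
    fourier r (f_r r n a mu) xi =
      (powR 2 (2 * r%:R * a + r%:R * (r%:R - 5) / 4
               + (\sum_(1 <= j < r) (j * n j.+1)%N)%:R))%:C *
      \prod_(1 <= j < r.+1)
        ((pochhammer (2 * ((nsuf r n j.+1)%:R + mu + (r%:R - j%:R) / 2)) (n j)
            / ((n j)`!)%:R)%:C
         * Theta r a mu n j (xi j))
    /\
    (forall j, (1 <= j <= r)%N ->
      Theta r a mu n j (xi j) =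
        ((n j)`!)%:R /
          ('i ^+ (n j)
           * (pochhammer ((nsuf r n j.+1)%:R + mu + (r%:R - j%:R + 1) / 2) (n j))%:C
           * (pochhammer ((nsuf r n j.+1)%:R + 2 * a + (r%:R - j%:R) / 2) (n j))%:C)
        * Beta (theta_arg r a n j (xi j)) (theta_arg r a n j (- xi j))
        * contHahn (n j) ((xi j / 2)%:C)
            ((a + (nsuf r n j.+1)%:R / 2 + (r%:R - j%:R) / 4)%:C)
            ((mu - a + ((nsuf r n j.+1)%:R + 1) / 2 + (r%:R - j%:R) / 4)%:C)
            ((mu - a + ((nsuf r n j.+1)%:R + 1) / 2 + (r%:R - j%:R) / 4)%:C)
            ((a + (nsuf r n j.+1)%:R / 2 + (r%:R - j%:R) / 4)%:C)).
Proof.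
move=> _ a0 hne xi; split.
  rewrite /fourier.
  rewrite (eq_iint _ _ _ (fun x => wave_f_r x r n a mu xi)).
  rewrite (iint_prod _ (fun j => gegen_wave (n j) (exponent r n a j)
    (ball_lambda r mu n j) (xi j))); last first.
    by move=> j /andP[_ jr]; apply: cintegrable_gegen_wave; exact: exponent_gt0.
  (* The power of 2 is split into one factor [2^(2 A_j - 1)] per variable, so that the products can
     be compared factor by factor. *)
  rewrite mul1r -sum_exponent -prod_powR2 (rmorph_prod (real_complex R)) -big_split /=.
  apply: eq_big_nat => j /andP[_ jr].
  rewrite CInt_gegen_wave ?exponent_gt0 // ThetaE /ball_lambda.
  by congr (_ * (((pochhammer _ _) / _)%:C * _)); ring.
move=> j jr; have /andP[_ jr'] := jr.
set lam2 := (nsuf r n j.+1)%:R + mu + (r%:R - j%:R + 1) / 2 : R.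
set A2 := (nsuf r n j.+1)%:R + 2 * a + (r%:R - j%:R) / 2 : R.
have A2E : A2 = 2 * exponent r n a j by rewrite /A2 /exponent; field.
have A20 : 0 < A2 by rewrite A2E mulr_gt0 // exponent_gt0.
(* The Hahn normalisation divides by this symbol; [hne] says that none of its factors vanishes. *)
have P1 : (pochhammer lam2 (n j))%:C != 0 :> R[i].
  rewrite -(rmorph0 (real_complex R)) (inj_eq (@complexI R)).
  by apply/prodf_neq0 => i _; apply: hne.
have P2 : (pochhammer A2 (n j))%:C != 0 :> R[i].
  rewrite -(rmorph0 (real_complex R)) (inj_eq (@complexI R)).
  by apply/prodf_neq0 => i _; rewrite lt0r_neq0 // ltr_wpDr.
rewrite /contHahn /Theta; cbv zeta; rewrite -/lam2 -/A2 rmorph_nat.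
(* The Hahn parameters are [al], [be], [be], [al]. The sums [al + be] and [al + al] are the lower
   parameters [lam2] and [A2], and the sum of all four less 1 is twice the Gegenbauer parameter, so
   both sides contain the same 3F2. *)
set al : R := a + _ / 2 + _; set be : R := mu - a + _ + _.
have -> : al%:C + be%:C = lam2%:C :> R[i].
  by rewrite -rmorphD /=; congr _%:C; rewrite /al /be /lam2; field.
have -> : al%:C + al%:C = A2%:C :> R[i].
  by rewrite -rmorphD /=; congr _%:C; rewrite /al /A2; field.
have -> : al%:C + 'i * (xi j / 2)%:C = theta_arg r a n j (xi j).
  by apply: complex_eq => /=; rewrite /al; ring.
have -> : (n j)%:R + al%:C + be%:C + be%:C + al%:C - 1 =
    ((n j)%:R + 2 * ((nsuf r n j.+1)%:R + mu + (r%:R - j%:R) / 2))%:C :> R[i].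
  rewrite -(rmorph_nat (real_complex R) (n j)) -!rmorphD -(rmorph1 (real_complex R)) -rmorphB /=.
  by congr _%:C; rewrite /al /be; field.
rewrite !pochhammer_real.
set F := pFq _ _ 1; set B := Beta _ _.
have i0 : 'i ^+ n j != 0 :> R[i] by rewrite expf_neq0 // neq0Ci.
have f0 : ((n j)`!)%:R != 0 :> R[i] by rewrite pnatr_eq0 -lt0n fact_gt0.
clearbody F B.
by field; rewrite i0 P1 P2 f0.
Qed.
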